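(* If $\mathbf{x}\in\mathcal{G}^{*}$, then $\mathbf{x}$ is $\Gamma$-local-rule-constant.
   Context: Let $\widetilde{\mathbb{Z}}=\mathbb{Z}\cup\{-\infty,+\infty\}$ and $X=\widetilde{\mathbb{Z}}^{\mathbb{Z}}$. Identify $\mathbb{Z}_5$ with $\{-2,-1,0,1,2\}$ and let $\oplus$ denote addition mod $5$ with representatives in this set. For $m\in\mathbb{Z}$ and $n\in\widetilde{\mathbb{Z}}$ let the clamped gradient $\delta_m(n)\in\{-2,\dots,2\}$ be $2$ if $n>m+1$, $-2$ if $n<m-1$, and $n-m$ otherwise. The sand automaton $\Gamma:X\to X$ is defined by $\Gamma(\mathbf{x})_i=x_i$ if $x_i=\pm\infty$, and, if $x_i\in\mathbb{Z}$, $$\Gamma(\mathbf{x})_i=x_i+\bigl(\delta_{x_i}(x_{i-1})\oplus\delta_{x_i}(x_{i+1})\bigr),$$ where the outer sum is taken in $\mathbb{Z}$. A configuration $\mathbf{x}$ is $\Gamma$-local-rule-constant if for some $\mathbf{y}\in X$, $\Gamma^n(\mathbf{x})=\mathbf{x}+n\mathbf{y}$ (coordinatewise) for every $n\in\mathbb{N}$. For $\mathbf{x}$ with all entries finite, the gradient sequence of $\mathbf{x}$ is $\Delta(\mathbf{x})=(\Delta(\mathbf{x})_i)_{i\in\mathbb{Z}}$ with $\Delta(\mathbf{x})_i=\binom{L_i}{R_i}$, $L_i=\delta_{x_i}(x_{i-1})$, $R_i=\delta_{x_i}(x_{i+1})$ (gradients are defined only at finite entries). Consider the following finite words of gradient pairs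 (''cycle segments''), each with an order (the common value of $L\oplus R$ on its pairs): A: $\binom{2}{-1}\binom{1}{0}\binom{0}{1}\binom{-1}{2}$, order $1$; B: $\binom{-2}{-2}$, order $1$; C: $\binom{2}{0}\binom{0}{2}$, order $2$; D: $\binom{-2}{-1}\binom{1}{1}\binom{-1}{-2}$, order $2$; E: $\binom{2}{-2}$, order $0$; F: $\binom{-2}{2}$, order $0$; G: $\binom{-2}{0}\binom{0}{-2}$, order $-2$; H: $\binom{2}{1}\binom{-1}{-1}\binom{1}{2}$, order $-2$; I: $\binom{-2}{1}\binom{-1}{0}\binom{0}{-1}\binom{1}{-2}$, order $-1$; J: $\binom{2}{2}$, order $-1$; K: $\binom{-1}{1}$, order $0$; L: $\binom{1}{-1}$, order $0$; M: $\binom{0}{0}$, order $0$. Let $\mathcal{H}$ be the directed graph with vertices A,…,M and an edge from $V$ to $V'$ if and only if: (1) if the segment of $V$ ends with a pair $\binom{*}{a}$ then the segment of $V'$ starts with a pair $\binom{-a}{\star}$; (2) if the segment of $V$ ends with a pair $\binom{*}{2}$ and has order $j$, then the segment of $V'$ has order at least $j$; (3) if the segment of $V$ ends with a pair $\binom{*}{-2}$ and has order $j$, then the segment of $V'$ has order at most $j$. (Loops are allowed.) $\mathcal{G}^{*}$ is the set of all configurations $\mathbf{x}\in X$ such that the gradient sequence $\Delta(\mathbf{x})$ is the bi-infinite concatenation of the segments along some bi-infinite path $\ldots V_{-1}V_0V_1\ldots$ in $\mathcal{H}$. *)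

(* Defs.v *)
From mathcomp Require Import all_boot all_order all_algebra.
From mathcomp Require Import constructive_ereal.

Set Implicit Arguments.
Unset Strict Implicit.
Unset Printing Implicit Defensive.

Import Order.TTheory GRing.Theory Num.Theory.
Local Open Scope ring_scope.

(* \bar int is Z with -oo and +oo adjoined. *)
Definition config : Type := int -> \bar int.

(* Addition mod 5 with representatives in {-2, ..., 2}; intdiv's %% takes
   values in {0, ..., 4}. *)
Definition oplus (a b : int) : int := ((a + b + 2) %% 5)%Z - 2.

(* The third branch is only reached when n is finite, so fine n is n. *)
Definition clamp (m : int) (n : \bar int) : int :=
  if ((m + 1)%:E < n)%E then 2
  else if (n < (m - 1)%:E)%E then -2
  else fine n - m.

Definition Gamma (x : config) : config := fun i =>
  if x i is v%:E
  then (v + oplus (clamp v (x (i - 1))) (clamp v (x (i + 1))))%:E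
  else x i.

(* In \bar int, y *+ 0 = 0 and y *+ n.+1 = y for y infinite, and the
   undetermined sum of opposite infinities is -oo. The latter convention does
   not affect local_rule_constant Gamma: Gamma preserves both infinite and
   finite entries, so where x i is infinite y i = 0 always works, and where x i
   is finite y i has to be finite. *)
Definition local_rule_constant (Phi : config -> config) (x : config) : Prop :=
  exists y : config, forall (n : nat) (i : int),
    iter n Phi x i = (x i + y i *+ n)%E.

Definition finite_config (x : config) : Prop :=
  forall i : int, x i \is a fin_num.

(* A pair (L, R) of gradients, written as a column in the literature. *)
Definition gradpair : Type := (int * int)%type.

(* Meaningful only for x satisfying finite_config. *)
Definition gradseq (x : config) : int -> gradpair := fun i =>
  (clamp (fine (x i)) (x (i - 1)), clamp (fine (x i)) (x (i + 1))).

Inductive vertex : Type :=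
  VA | VB | VC | VD | VE | VF | VG | VH | VI | VJ | VK | VL | VM.

Definition segment (V : vertex) : seq gradpair :=
  match V with
  | VA => [:: (2, -1); (1, 0); (0, 1); (-1, 2)]
  | VB => [:: (-2, -2)]
  | VC => [:: (2, 0); (0, 2)]
  | VD => [:: (-2, -1); (1, 1); (-1, -2)]
  | VE => [:: (2, -2)]
  | VF => [:: (-2, 2)]
  | VG => [:: (-2, 0); (0, -2)]
  | VH => [:: (2, 1); (-1, -1); (1, 2)]
  | VI => [:: (-2, 1); (-1, 0); (0, -1); (1, -2)]
  | VJ => [:: (2, 2)]
  | VK => [:: (-1, 1)]
  | VL => [:: (1, -1)]
  | VM => [:: (0, 0)]
  end.

Definition seg_order (V : vertex) : int :=
  match V with
  | VA => 1
  | VB => 1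
  | VC => 2
  | VD => 2
  | VE => 0
  | VF => 0
  | VG => -2
  | VH => -2
  | VI => -1
  | VJ => -1
  | VK => 0
  | VL => 0
  | VM => 0
  end.

Lemma seg_order_oplus (V : vertex) :
  all (fun d => oplus d.1 d.2 == seg_order V) (segment V).
Proof. by case: V. Qed.

Lemma segment_neq_nil (V : vertex) : segment V <> [::].
Proof. by case: V. Qed.

(* The default pairs are never used, by segment_neq_nil. *)
Definition startL (V : vertex) : int := (head (0, 0) (segment V)).1.
Definition endR (V : vertex) : int := (last (0, 0) (segment V)).2.

Definition edge (V V' : vertex) : Prop :=
  [/\ startL V' = - endR V,
      endR V = 2 -> seg_order V <= seg_order V' &
      endR V = -2 -> seg_order V' <= seg_order V].

(* u is the concatenation of the words w k, k in Z, up to the choice of origin: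
   p k is the position at which w k starts. When no w k is empty, p is strictly
   increasing, so the blocks tile all of Z. *)
Definition biconcat (T : Type) (w : int -> seq T) (u : int -> T) : Prop :=
  exists p : int -> int, forall k : int,
    p (k + 1) = p k + (size (w k))%:Z /\
    mkseq (fun j => u (p k + j%:Z)) (size (w k)) = w k.

Definition Gstar (x : config) : Prop :=
  finite_config x /\
  exists V : int -> vertex,
    (forall k : int, edge (V k) (V (k + 1))) /\
    biconcat (fun k => segment (V k)) (gradseq x).

(* Main.v *)
Require Import Defs.
From mathcomp Require Import all_boot all_order all_algebra.
From mathcomp Require Import constructive_ereal.
From mathcomp Require Import zify.

Set Implicit Arguments.
Unset Strict Implicit.
Unset Printing Implicit Defensive.

Import Order.TTheory GRing.Theory Num.Theory.
Local Open Scope ring_scope.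

(** Along a path of the graph, the increment [d i = L_i oplus R_i] that the
    automaton adds at [i] is the order of the segment containing [i].  The three
    conditions on edges ensure that adding [d] to the configuration never
    changes a gradient.  Inside a segment neighbours move together.  At a
    boundary with gradient 2 the right-hand side moves up at least as fast as
    the left-hand side, so the difference stays at least 2 and is still clamped
    to 2; symmetrically for -2.  A segment ending in a gradient of -1, 0 or 1
    is one of K, L, M, and condition (1) allows each of these to be followed
    only by itself, so again both sides move together.  Since the increments
    depend on the gradients only, they never change, and the [n]-th iterate
    is [x + n d].

    [Gstar_increment_compat] reads this relation between the increments at [i]
    and [i + 1] off the path, [clampz_drift] shows that a gradient survives such
    a drift, and [local_rule_constant_of_compat] does the induction. *)

(** * Concatenations indexed by the integers *)

(** The blocks are nonempty, so their starting points are unbounded on both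
    sides and no position is missed; walking one step at a time from the start
    of block 0, a position either stays in its block or enters an adjacent
    one. *)
Lemma block_cover (w p : int -> int) (w_gt0 : forall k, 0 < w k)
    (pS : forall k : int, p (k + 1) = p k + w k) (i : int) :
  exists k : int, p k <= i < p (k + 1).
Proof.
have step_up (m : int) : (exists k : int, p k <= m < p (k + 1)) ->
    exists k : int, p k <= m + 1 < p (k + 1).
  move=> [k /andP[le_km lt_mk]].
  have [lt_m1|le_m1] := ltP (m + 1) (p (k + 1)); first by exists k; lia.
  by exists (k + 1); have := pS (k + 1); have := w_gt0 (k + 1); lia.
have step_down (m : int) : (exists k : int, p k <= m < p (k + 1)) ->
    exists k : int, p k <= m - 1 < p (k + 1).
  move=> [k /andP[le_km lt_mk]].
  have [le_m1|lt_m1] := leP (p k) (m - 1); first by exists k; lia.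
  exists (k - 1); have := pS (k - 1); have := w_gt0 (k - 1).
  by rewrite subrK; lia.
have -> : i = p 0 + (i - p 0) by lia.
elim: (i - p 0) => [|n IHn|n IHn].
- by exists 0; have := pS 0; have := w_gt0 0; lia.
- by have [k Hk] := step_up _ IHn; exists k; lia.
- by have [k Hk] := step_down _ IHn; exists k; lia.
Qed.

(** Properties of adjacent letters of a concatenation can thus be checked
    inside the blocks and at the junctions separately. *)
Lemma biconcat_adjacent (T : eqType) (x0 : T) (w : int -> seq T) (u : int -> T)
    (w_neq0 : forall k, w k <> [::]) (wu : biconcat w u) (i : int) :
  exists k,
    (u i \in w k /\ u (i + 1) \in w k) \/
    (u i = last x0 (w k) /\ u (i + 1) = head x0 (w (k + 1))).
Proof.
have [p Hp] := wu.
have w_gt0 k : 0 < (size (w k))%:Z by move: (w_neq0 k); case: (w k).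
have [k /andP[le_ki lt_ik]] := block_cover w_gt0 (fun k => (Hp k).1) i.
have uE l j : (j < size (w l))%N -> u (p l + j%:Z) = nth x0 (w l) j.
  by move=> lt_j; rewrite -[in RHS](Hp l).2 nth_mkseq.
have [j Dj] : exists j : nat, i = p k + j%:Z by exists `|i - p k|%N; lia.
have pS := (Hp k).1.
have lt_j : (j < size (w k))%N by lia.
exists k; have [lt_j1|le_j1] := ltnP j.+1 (size (w k)); [left|right].
  have -> : i + 1 = p k + j.+1%:Z by lia.
  by rewrite Dj !uE ?mem_nth.
have -> : i + 1 = p (k + 1) + 0%:Z by lia.
rewrite Dj !uE // ?nth0 -?nth_last; last by have := w_gt0 (k + 1).
by split=> //; congr nth; lia.
Qed.

(** * Gradients under a drift *)

Definition clampz (d : int) : int :=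
  if 1 < d then 2 else if d < -1 then -2 else d.

Lemma clamp_fin (m n : int) : clamp m n%:E = clampz (n - m).
Proof.
rewrite /clamp /clampz !lte_fin /=.
have -> : (m + 1 < n) = (1 < n - m) by lia.
by have -> : (n < m - 1) = (n - m < -1) by lia.
Qed.

Lemma clampzN (d : int) : clampz (- d) = - clampz d.
Proof. by rewrite /clampz; do !case: ifP; lia. Qed.

(** Here [a] is the gradient from a site towards its right neighbour, and the
    two sites are repeatedly incremented by [j] and [j'].  A gradient 2 leaves
    the difference of heights free to grow, -2 leaves it free to shrink, and any
    other gradient determines it. *)
Definition drift_compat (a j j' : int) : Prop :=
  [/\ a = 2 -> j <= j', a = -2 -> j' <= j & a != 2 -> a != -2 -> j = j'].

Lemma clampz_drift (m m' j j' : int) (n : nat) :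
  drift_compat (clampz (m' - m)) j j' ->
  clampz ((m' + j' *+ n) - (m + j *+ n)) = clampz (m' - m).
Proof.
have -> : m' + j' *+ n - (m + j *+ n) = m' - m + (j' - j) * n%:Z.
  by rewrite -(mulr_natr j) -(mulr_natr j') natz; lia.
move: (m' - m) => d; rewrite /drift_compat /clampz.
have [gt_d1|le_d1] := ltP 1 d.
  by case=> /(_ erefl) le_jj' _ _; rewrite ifT //; nia.
have [lt_d1|ge_d1] := ltP d (-1).
  by case=> _ /(_ erefl) le_j'j _; rewrite ifF ?ifT //; nia.
case=> _ _ <-; [|lia|lia]; rewrite subrr mul0r addr0.
by rewrite !ifF //; lia.
Qed.

(** Since [L] at [i + 1] is the opposite of [R] at [i], a condition on the right
    gradients controls the left ones too. *)
Lemma local_rule_constant_of_compat (x : config) (z d : int -> int)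
    (xE : forall i, x i = (z i)%:E)
    (dE : forall i, d i =
       oplus (clampz (z (i - 1) - z i)) (clampz (z (i + 1) - z i)))
    (compat : forall i,
       drift_compat (clampz (z (i + 1) - z i)) (d i) (d (i + 1))) :
  local_rule_constant Gamma x.
Proof.
exists (fun i => (d i)%:E) => n i.
rewrite -EFin_natmul xE -EFinD.
elim: n i => [|n IHn] i; first by rewrite /= xE mulr0n addr0.
have := compat (i - 1); rewrite subrK => compat_left.
rewrite iterS /Gamma !IHn !clamp_fin (clampz_drift _ (compat i)).
rewrite -opprB clampzN (clampz_drift _ compat_left) -clampzN opprB.
by rewrite -dE mulrSr addrA.
Qed.

(** * Increments along a path of segments *)

Lemma segment_oplus (V : vertex) (g : gradpair) :
  g \in segment V -> oplus g.1 g.2 = seg_order V.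
Proof. by move=> gV; apply/eqP/(allP (seg_order_oplus V)). Qed.

Lemma edge_drift_compat (V V' : vertex) :
  edge V V' -> drift_compat (endR V) (seg_order V) (seg_order V').
Proof.
case=> eqLR up down; split=> // n2 nN2.
(* Only K, L and M end in a gradient other than 2 and -2, and the start of V'
   then forces V' = V. *)
by case: V n2 nN2 eqLR {up down} => // _ _; case: V'.
Qed.

Lemma Gstar_increment_compat (x : config) (i : int) : Gstar x ->
  let d k := oplus (gradseq x k).1 (gradseq x k).2 in
  drift_compat (gradseq x i).2 (d i) (d (i + 1)).
Proof.
move=> [_ [V [edgeV catV]]] d; rewrite {}/d.
have [k] := biconcat_adjacent (0, 0) (fun k => @segment_neq_nil (V k)) catV i.
case=> -[gi gi1].
  by rewrite (segment_oplus gi) (segment_oplus gi1).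
have last_in W : last (0, 0) (segment W) \in segment W by case: W.
have head_in W : head (0, 0) (segment W) \in segment W by case: W.
rewrite gi gi1 (segment_oplus (last_in _)) (segment_oplus (head_in _)).
exact: edge_drift_compat (edgeV k).
Qed.

Theorem theorem4p9 (x : config) (hx : Gstar x) : local_rule_constant Gamma x.
Proof.
pose z i := fine (x i).
have xE i : x i = (z i)%:E by rewrite /z fineK //; apply: hx.1.
have gradE i :
    gradseq x i = (clampz (z (i - 1) - z i), clampz (z (i + 1) - z i)).
  by rewrite /gradseq !xE /= !clamp_fin.
apply: (local_rule_constant_of_compat
  (d := fun i => oplus (gradseq x i).1 (gradseq x i).2) xE) => i.
  by rewrite gradE.
by have := Gstar_increment_compat i hx; rewrite {1}gradE.
Qed.
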